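(* Let $\mu>0$ and let $\lambda_1,\lambda_2\in\mathbb{R}$ with $0<\lambda_1<\lambda_2$. Then $\{1,\ln_\mu^{\lambda_1},\ln_\mu^{\lambda_2}\}$ is a Korovkin subset of $C([0,1])$.
   Context: For fixed $\mu>0$, $\ln_\mu(x):=\ln(1+\mu+x)$ for $x\in[0,1]$ (a strictly positive function), and $\ln_\mu^{\lambda}(x):=(\ln_\mu(x))^{\lambda}$. The symbol $1$ denotes the constant function. $C([0,1])$ is the space of real continuous functions on $[0,1]$ with the sup norm. A subset $H\subset C([0,1])$ containing the constant function $1$ is a Korovkin subset of $C([0,1])$ if for every sequence $(T_n)_{n\in\mathbb{N}}$ of positive linear operators $T_n:C([0,1])\to C([0,1])$ such that $T_n(g)\to g$ uniformly on $[0,1]$ for every $g\in H$, one has $T_n(f)\to f$ uniformly on $[0,1]$ for every $f\in C([0,1])$. *)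

(* Defs.v *)
From HB Require Import structures.
From mathcomp Require Import all_boot all_order all_algebra.
From mathcomp Require Import all_classical all_reals all_analysis.

Set Implicit Arguments.
Unset Strict Implicit.
Unset Printing Implicit Defensive.

Import Order.TTheory GRing.Theory Num.Theory numFieldNormedType.Exports.
Local Open Scope classical_set_scope.
Local Open Scope ring_scope.

(* The library's [continuousType X R] comes without its pointwise linear
   structure, which is needed to speak of linear operators on C(X). *)
Section continuous_lmodule.
Context {X : topologicalType} {R : realType}.
Implicit Types (f g h : continuousType X R) (a b : R).

Let zero_cts : continuousType X R := cst 0.

Let opp_continuous f : continuous (fun x => - f x).
Proof. by move=> x; apply: continuousN; exact: cts_fun. Qed.

Let opp_cts f : continuousType X R := mkcts (@opp_continuous f).

Let add_continuous f g : continuous (fun x => f x + g x).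
Proof. by move=> x; apply: continuousD; exact: cts_fun. Qed.

Let add_cts f g : continuousType X R := mkcts (@add_continuous f g).

Let scale_continuous a f : continuous (fun x => a * f x).
Proof.
by move=> x; apply: continuousM; [exact: cst_continuous|exact: cts_fun].
Qed.

Let scale_cts a f : continuousType X R := mkcts (@scale_continuous a f).

Let addcA : associative add_cts.
Proof. by move=> f g h; apply/continuousEP => x /=; exact: addrA. Qed.

Let addcC : commutative add_cts.
Proof. by move=> f g; apply/continuousEP => x /=; exact: addrC. Qed.

Let add0c : left_id zero_cts add_cts.
Proof. by move=> f; apply/continuousEP => x /=; exact: add0r. Qed.

Let addNc : left_inverse zero_cts opp_cts add_cts.
Proof. by move=> f; apply/continuousEP => x /=; exact: addNr. Qed.

HB.instance Definition _ :=
  GRing.isZmodule.Build (continuousType X R) addcA addcC add0c addNc.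

Let scalecA a b f : scale_cts a (scale_cts b f) = scale_cts (a * b) f.
Proof. by apply/continuousEP => x /=; exact: mulrA. Qed.

Let scale1c : left_id 1 scale_cts.
Proof. by move=> f; apply/continuousEP => x /=; exact: mul1r. Qed.

Let scalecDr : right_distributive scale_cts +%R.
Proof. by move=> a f g; apply/continuousEP => x /=; exact: mulrDr. Qed.

Let scalecDl f : {morph scale_cts^~ f : a b / a + b}.
Proof. by move=> a b; apply/continuousEP => x /=; exact: mulrDl. Qed.

HB.instance Definition _ :=
  GRing.Zmodule_isLmodule.Build R (continuousType X R)
    scalecA scale1c scalecDr scalecDl.

Lemma add_ctsE f g x : (f + g) x = f x + g x. Proof. by []. Qed.

Lemma opp_ctsE f x : (- f) x = - f x. Proof. by []. Qed.

Lemma scale_ctsE a f x : (a *: f) x = a * f x. Proof. by []. Qed.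

End continuous_lmodule.

(* [set_type] carries the subspace topology inherited from R. *)
Definition unit_itv (R : realType) : topologicalType :=
  @set_type R `[0, 1]%classic.

Definition unit_val (R : realType) (x : unit_itv R) : R := @set_val R _ x.

Lemma unit_val_ge0 (R : realType) (x : unit_itv R) : 0 <= unit_val x.
Proof. by have /set_mem/= := valP x; rewrite in_itv/= => /andP[]. Qed.

Lemma unit_val_continuous (R : realType) : continuous (@unit_val R).
Proof. by move=> x; exact: initial_continuous. Qed.

Notation C01 R := (continuousType (unit_itv R) R).

Definition one_C01 (R : realType) : C01 R := cst 1.

Definition positive_operator (R : realType) (T : C01 R -> C01 R) : Prop :=
  forall f : C01 R, (forall x, 0 <= f x) -> forall x, 0 <= T f x.

Definition cvg_uniformly (R : realType) (u : nat -> C01 R) (f : C01 R) : Prop :=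
  {uniform, (fun n => u n : unit_itv R -> R) @ \oo --> (f : unit_itv R -> R)}.

Lemma cvg_uniformlyP (R : realType) (u : nat -> C01 R) (f : C01 R) :
  cvg_uniformly u f <->
  forall e : R, 0 < e -> \forall n \near \oo, forall x, `|f x - u n x| < e.
Proof.
rewrite /cvg_uniformly; split.
  move=> H e e0.
  have : nbhs ((fun n => u n : unit_itv R -> R) @ \oo)
     [set h : unit_itv R -> R | forall x, setT x -> `|f x - h x| < e].
    apply: H; apply/uniform_nbhs; exists [set xy | ball xy.1 e xy.2]; split.
      exact: entourage_ball (PosNum e0).
    by move=> h.
  by rewrite nbhs_simpl /=; apply: filterS => n /= h x; exact: h.
move=> H A /uniform_nbhs [E [entE sub]].
move: entE; rewrite -entourage_ballE => -[e /= e0 he].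
rewrite nbhs_simpl /=; apply: filterS (H _ e0) => n hn.
by apply: sub => y _; apply: he => /=; exact: hn.
Qed.

Definition korovkin_subset (R : realType) (H : set (C01 R)) : Prop :=
  H (one_C01 R) /\
  forall T : nat -> {linear C01 R -> C01 R},
    (forall n, positive_operator (T n)) ->
    (forall g, H g -> cvg_uniformly (fun n => T n g) g) ->
    forall f, cvg_uniformly (fun n => T n f) f.

Section ln_mu.
Context {R : realType}.
Implicit Types (mu lambda : R) (x : unit_itv R).

Definition ln_mu mu x : R := ln (1 + mu + unit_val x).

Lemma ln_mu_gt0 mu x : 0 < mu -> 0 < ln_mu mu x.
Proof.
move=> mu0; apply: ln_gt0; rewrite -addrA ltrDl.
by rewrite ltr_wpDr// unit_val_ge0.
Qed.

Lemma ln_mu_powR_continuous mu (mu_gt0 : 0 < mu) lambda :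
  continuous (fun x => ln_mu mu x `^ lambda).
Proof.
have argc : continuous (fun x => 1 + mu + unit_val x).
  move=> x; apply: (@continuousD _ _ _ (cst (1 + mu)) (@unit_val R)).
    exact: cst_continuous.
  exact: unit_val_continuous.
have lnc : continuous (ln_mu mu).
  move=> x; have arg_gt0 : 0 < 1 + mu + unit_val x.
    by rewrite ltr_wpDr ?unit_val_ge0// addr_gt0.
  exact: continuous_comp (argc x) (continuous_ln arg_gt0).
have -> : (fun x => ln_mu mu x `^ lambda) =
          (fun x => expR (lambda * ln (ln_mu mu x))).
  by apply/funext => x; rewrite /powR gt_eqF// ln_mu_gt0.
have expoc : continuous (fun x => lambda * ln (ln_mu mu x)).
  move=> x.
  have llc := continuous_comp (lnc x) (continuous_ln (ln_mu_gt0 x mu_gt0)).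
  exact: continuousM (@cst_continuous _ _ lambda x) llc.
by move=> x; exact: continuous_comp (expoc x) (@continuous_expR R _).
Qed.

(* Positivity of [mu] is needed for the function to lie in C([0,1]). *)
Definition ln_mu_pow mu (mu_gt0 : 0 < mu) lambda : C01 R :=
  mkcts (@ln_mu_powR_continuous mu mu_gt0 lambda).

End ln_mu.

(* Main.v *)
(** With [L = ln_mu mu] and [v = ln (L x) - ln (L y)], the function
    [lambda1 * (expR (lambda2 * v) - 1) - lambda2 * (expR (lambda1 * v) - 1)]
    is, for fixed [y], a linear combination of [1], [L x `^ lambda1] and
    [L x `^ lambda2] whose coefficients are continuous in [y]; by strict
    convexity it is positive for [x <> y], and it vanishes for [x = y]. Calling
    it [P (x, y)], compactness gives, for every continuous [f] and [e > 0], some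
    [M] with [|f x - f y| <= e + M * P (x, y)]. A positive operator [T n]
    preserves this bound in [x], and [T n (P (., y)) y] tends to
    [P (y, y) = 0] uniformly in [y]. *)

Require Import Defs.
From mathcomp Require Import all_boot all_order all_algebra.
From mathcomp Require Import all_classical all_reals all_analysis.
From mathcomp Require Import ring lra.

Import Order.TTheory GRing.Theory Num.Theory numFieldNormedType.Exports.
Local Open Scope classical_set_scope.
Local Open Scope ring_scope.

Lemma sum_ctsE (X : topologicalType) (R : realType) (I : Type) (r : seq I)
  (F : I -> continuousType X R) (x : X) :
  (\sum_(i <- r) F i) x = \sum_(i <- r) F i x.
Proof. by elim/big_rec2: _ => // i y f _ <-. Qed.

(** The clamp [max 0 (min 1 x)] retracts the line continuously onto the interval, so the whole type
    [unit_itv R] is a continuous image of a compact segment. *)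
Lemma compact_unit_itv (R : realType) : compact [set: unit_itv R].
Proof.
have clampP (x : R) : Num.max 0 (Num.min 1 x) \in `[0, 1]%classic.
  by apply/mem_set; rewrite /= in_itv /= le_max lexx ge_max ler01 ge_min lexx.
pose clamp (x : R) : unit_itv R := SigSub (clampP x).
have clamp_cont : continuous clamp.
  apply: continuous_comp_initial => x.
  apply: (@continuous_max R R (cst 0) (cst 1 \min id)).
    exact: cst_continuous.
  by apply: (@continuous_min R R (cst 1) id) => //; exact: cst_continuous.
have -> : [set: unit_itv R] = clamp @` `[0, 1]%classic.
  apply/seteqP; split => // y _; have /set_mem/= y01 := valP y.
  exists (val y) => //; apply/val_inj => /=.
  move: y01; rewrite in_itv /= => /andP[y0 y1].
  by rewrite min_r// max_r.
apply: continuous_compact; last exact: segment_compact.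
exact: continuous_subspaceT.
Qed.

(** Near a diagonal point the term [e] alone suffices, by continuity of [f]. Near any other point
    [P] stays above a positive constant, so every large [n] works as [M]. Compactness of the square,
    as a near-covering property, yields one [n] for all pairs. *)
Lemma compact_penalty (X : topologicalType) (R : realType) (f : X -> R)
  (P : X * X -> R) (e : R) :
  compact [set: X] -> continuous f -> continuous P ->
  (forall x, P (x, x) = 0) -> (forall x y, x <> y -> 0 < P (x, y)) ->
  0 < e -> exists M : R, forall x y, `|f x - f y| <= e + M * P (x, y).
Proof.
move=> cX cf cP P0 Pgt0 e0.
have P_ge0 z : 0 <= P z.
  by case: z => x y; have [->|/eqP/Pgt0/ltW//] := eqVneq x y; rewrite P0.
have := compact_setX cX cX; rewrite setXTT compact_near_coveringP.
move=> /(_ nat \oo (fun n z => `|f z.1 - f z.2| <= e + n%:R * P z)).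
have cfd : continuous (fun z : X * X => `|f z.1 - f z.2|).
  move=> z; apply: cvg_norm; apply: cvgB.
    exact: (continuous_comp (@cvg_fst _ _ _ _ _) (cf z.1)).
  exact: (continuous_comp (@cvg_snd _ _ _ _ _) (cf z.2)).
case=> [|N _ /(_ N (leqnn _)) hN].
  move=> [x y] _; have [<-|/eqP/Pgt0 Pxy] := eqVneq x y.
    have : \forall z \near (x, x), `|f z.1 - f z.2| < e.
      by apply: (cvgr_lt _ (cfd (x, x))); rewrite /= subrr normr0.
    move=> H; near=> z n; rewrite /=.
    apply: le_trans (_ : e <= _); last by rewrite lerDl mulr_ge0.
    by apply: ltW; near: z.
  set d := `|f x - f y| + 1.
  have H1 : \forall z \near (x, y), `|f z.1 - f z.2| < d.
    by apply: (cvgr_lt _ (cfd (x, y))); rewrite /= ltrDl.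
  have H2 : \forall z \near (x, y), P (x, y) / 2 < P z.
    by apply: (cvgr_gt _ (cP (x, y))); lra.
  have H3 := @nbhs_infty_gtr R (d / (P (x, y) / 2)).
  near=> z n; rewrite /=.
  have h1 : `|f z.1 - f z.2| < d by near: z.
  have h2 : P (x, y) / 2 < P z by near: z.
  have h3 : d / (P (x, y) / 2) < n%:R by near: n.
  apply: ltW; apply: (lt_le_trans h1).
  apply: (@le_trans _ _ (n%:R * P z)); last by rewrite lerDr ltW.
  apply: (@le_trans _ _ (n%:R * (P (x, y) / 2))).
    by rewrite -ler_pdivrMr ?divr_gt0// ltW.
  by apply: ler_wpM2l => //; exact: ltW.
by exists N%:R => x y; exact: (hN (x, y)).
Unshelve. all: by end_near. Qed.

Lemma positive_operator_norm_le (R : realType) (T : {linear C01 R -> C01 R})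
  (f h : C01 R) :
  positive_operator T -> (forall x, `|f x| <= h x) ->
  forall y, `|T f y| <= T h y.
Proof.
move=> Tpos fh y.
have hBf : 0 <= T (h - f) y.
  by apply: Tpos => x; rewrite add_ctsE opp_ctsE subr_ge0 (le_trans (ler_norm _)).
have hDf : 0 <= T (h + f) y.
  apply: Tpos => x; rewrite add_ctsE -[f x]opprK subr_ge0.
  by rewrite (le_trans (ler_norm _))// normrN.
move: hBf hDf; rewrite linearB linearD !add_ctsE opp_ctsE ler_norml => ? ?.
by apply/andP; split; lra.
Qed.

Lemma C01_bounded (R : realType) (c : C01 R) :
  exists2 B : R, 0 < B & forall x, `|c x| <= B.
Proof.
have cc : continuous c by exact: cts_fun.
have /compact_bounded[B [_ hB]] : compact (c @` [set: unit_itv R]).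
  apply: continuous_compact; last exact: compact_unit_itv.
  exact: continuous_subspaceT.
exists (`|B| + 1); first by rewrite ltr_wpDl.
move=> x; apply: hB; last by exists x.
by rewrite (le_lt_trans (ler_norm B))// ltrDl.
Qed.

(** A fixed continuous factor is bounded by compactness, hence harmless to uniform convergence. *)
Lemma cvg_uniformlyM (R : realType) (u : nat -> C01 R) (g c : C01 R) (e : R) :
  cvg_uniformly u g -> 0 < e ->
  \forall n \near \oo, forall x, `|c x * (g x - u n x)| < e.
Proof.
move=> /cvg_uniformlyP ug e0; have [B B0 cB] := C01_bounded R c.
have := ug (e / B) (divr_gt0 e0 B0); apply: filterS => n un x.
rewrite normrM; apply: (@le_lt_trans _ _ (B * `|g x - u n x|)).
  by rewrite ler_wpM2r.
by rewrite mulrC -ltr_pdivlMr.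
Qed.

Lemma korovkin_subset_penalty (R : realType) (H : set (C01 R)) (m : nat)
  (g c : 'I_m -> C01 R) :
  H (one_C01 R) -> (forall i, H (g i)) ->
  (forall y, \sum_(i < m) c i y * g i y = 0) ->
  (forall x y, x <> y -> 0 < \sum_(i < m) c i y * g i x) ->
  korovkin_subset H.
Proof.
move=> H1 Hg diag off; split=> // T Tpos Tcvg f.
apply/cvg_uniformlyP => e e0.
pose P (z : unit_itv R * unit_itv R) := \sum_(i < m) c i z.2 * g i z.1.
have Pcont : continuous P.
  apply: continuous_big => [|i _ z]; first exact: add_continuous.
  apply: cvgM.
    exact: (continuous_comp (@cvg_snd _ _ _ _ _) (@cts_fun _ _ (c i) z.2)).
  exact: (continuous_comp (@cvg_fst _ _ _ _ _) (@cts_fun _ _ (g i) z.1)).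
have d0 : 0 < e / 4 by rewrite divr_gt0.
have [M fM] := compact_penalty _ _ f P _ (compact_unit_itv R)
  (@cts_fun _ _ f) Pcont diag off d0.
(* With [y] frozen, [f y] and the [c i y] are scalars, so linearity carries them through [T n]; only
   then is the result evaluated at the same [y]. *)
have Tbound n y : `|T n f y - f y * T n (one_C01 R) y| <=
    e / 4 * T n (one_C01 R) y + M * \sum_(i < m) c i y * T n (g i) y.
  pose h := (e / 4) *: one_C01 R + M *: \sum_(i < m) c i y *: g i.
  have fE x : (f - f y *: one_C01 R) x = f x - f y.
    by rewrite add_ctsE opp_ctsE scale_ctsE mulr1.
  have hE x : h x = e / 4 + M * P (x, y).
    by rewrite add_ctsE !scale_ctsE sum_ctsE mulr1.
  have TfE : T n (f - f y *: one_C01 R) y = T n f y - f y * T n (one_C01 R) y.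
    by rewrite linearB linearZ.
  have ThE : T n h y =
      e / 4 * T n (one_C01 R) y + M * \sum_(i < m) c i y * T n (g i) y.
    rewrite linearD !linearZ linear_sum add_ctsE !scale_ctsE sum_ctsE.
    by under eq_bigr do rewrite linearZ.
  rewrite -TfE -ThE; apply: positive_operator_norm_le => // x.
  by rewrite fE hE.
have near_f := cvg_uniformlyM _ _ _ f _ (Tcvg _ H1) d0.
have near_1 := cvg_uniformlyM _ _ _ (one_C01 R) _ (Tcvg _ H1) ltr01.
(* The [m] error terms then total at most [e / 4]; [m.+1] keeps the divisor nonzero when [m = 0]. *)
pose q : R := e / 4 / m.+1%:R.
have q0 : 0 < q by rewrite divr_gt0.
(* Putting [M] into the coefficient avoids a case split on its sign. *)
have near_g : \forall n \near \oo, forall i, forall y,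
    `|(M *: c i) y * (g i y - T n (g i) y)| < q.
  by apply: filter_forall => i; apply: cvg_uniformlyM => //; exact: Tcvg.
near=> n => y.
have hf : `|f y * (one_C01 R y - T n (one_C01 R) y)| < e / 4.
  by move: y; near: n.
have h1 : `|one_C01 R y * (one_C01 R y - T n (one_C01 R) y)| < 1.
  by move: y {hf}; near: n.
have hg : forall i y, `|(M *: c i) y * (g i y - T n (g i) y)| < q.
  by near: n.
have hsum : M * \sum_(i < m) c i y * T n (g i) y <= e / 4.
  have -> : M * \sum_(i < m) c i y * T n (g i) y =
      \sum_(i < m) - ((M *: c i) y * (g i y - T n (g i) y)).
    (* Subtracting the vanishing diagonal sum exposes the errors [g i y - T n (g i) y]. *)
    have -> : \sum_(i < m) c i y * T n (g i) y =
        \sum_(i < m) c i y * T n (g i) y - \sum_(i < m) c i y * g i y.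
      by rewrite diag subr0.
    rewrite -sumrB mulr_sumr.
    by apply: eq_bigr => i _; rewrite scale_ctsE; ring.
  apply: (@le_trans _ _ (\sum_(i < m) q)).
    apply: ler_sum => i _; apply: ltW; apply: le_lt_trans (hg i y).
    by rewrite (le_trans (ler_norm _))// normrN.
  rewrite sumr_const card_ord -[leLHS]mulr_natr mulrAC ler_pdivrMr//.
  by rewrite ler_pM2l// ler_nat.
(* Error budget: [e / 4] from [hf], [e / 4] from [hsum], and [e / 2] from the remaining term, since
   [h1] gives [T n (one_C01 R) y < 2]. *)
have := Tbound n y; move: hf h1.
have -> : one_C01 R y = 1 by [].
rewrite mul1r => /ltr_normlP[f1 f2] /ltr_normlP[g1 g2] /ler_normlP[t1 t2].
have e4 : e / 4 * T n (one_C01 R) y <= e / 4 * 2 by rewrite ler_pM2l//; lra.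
by apply/ltr_normlP; split; nra.
Unshelve. all: by end_near. Qed.

(* Weighted AM-GM, from [expR z > 1 + z] at [z = - (a * v)] and
   [z = (b - a) * v]. *)
Lemma expR_slope_lt (R : realType) (a b v : R) :
  0 < a -> a < b -> v != 0 -> b * (expR (a * v) - 1) < a * (expR (b * v) - 1).
Proof.
move=> a0 ab v0.
have X1 : 1 + (b - a) * v < expR ((b - a) * v).
  by apply: expR_gt1Dx; rewrite mulf_neq0// subr_eq0 gt_eqF.
have Y1 : 1 + - (a * v) < expR (- (a * v)).
  by apply: expR_gt1Dx; rewrite oppr_eq0 mulf_neq0// gt_eqF.
have -> : expR (b * v) = expR (a * v) * expR ((b - a) * v).
  by rewrite -expRD; congr expR; ring.
have EY : expR (a * v) * expR (- (a * v)) = 1.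
  by rewrite -expRD subrr expR0.
have E0 := expR_gt0 (a * v).
(* Here [E], [X], [Y] stand for [expR (a * v)], [expR (- (a * v))], [expR ((b - a) * v)]; thus [X1]
   bounds [Y] and [Y1] bounds [X]. *)
move: X1 Y1 EY E0; move: (expR _) (expR _) (expR _) => E X Y X1 Y1 EY E0.
have ba : 0 < b - a by rewrite subr_gt0.
rewrite -subr_gt0.
have -> : a * (E * Y - 1) - b * (E - 1) =
          E * (a * (Y - (1 + (b - a) * v)) + (b - a) * (X - (1 - a * v))) +
          (b - a) * (1 - E * X) by ring.
rewrite EY subrr mulr0 addr0 mulr_gt0// addr_gt0// mulr_gt0// subr_gt0//.
Qed.

Lemma ln_mu_inj (R : realType) (mu : R) : 0 < mu -> injective (ln_mu mu).
Proof.
move=> mu0 x y xy; apply/val_inj.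
have pos z : 1 + mu + unit_val z \is Num.pos.
  by rewrite posrE ltr_wpDr ?unit_val_ge0// addr_gt0.
by have /addrI := ln_inj (pos x) (pos y) xy.
Qed.

Theorem proposition3p1 (R : realType) (mu lambda1 lambda2 : R)
  (mu_gt0 : 0 < mu) (lambda1_gt0 : 0 < lambda1)
  (lambda12 : lambda1 < lambda2) :
  korovkin_subset
    [set one_C01 R; ln_mu_pow mu_gt0 lambda1; ln_mu_pow mu_gt0 lambda2].
Proof.
pose g (i : 'I_3) : C01 R :=
  [:: one_C01 R; ln_mu_pow mu_gt0 lambda1; ln_mu_pow mu_gt0 lambda2]`_i.
(* In the expanded penalty, [expR (l * v x y)] factors into a power of [ln_mu mu x] and the inverse
   power at [y]. The latter joins the coefficient, whence the negative exponents; the constants add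
   up to [lambda2 - lambda1]. *)
pose c (i : 'I_3) : C01 R :=
  [:: (lambda2 - lambda1) *: one_C01 R;
      - lambda2 *: ln_mu_pow mu_gt0 (- lambda1);
      lambda1 *: ln_mu_pow mu_gt0 (- lambda2)]`_i.
pose v x y : R := ln (ln_mu mu x) - ln (ln_mu mu y).
have powM (l : R) x y : ln_mu mu y `^ (- l) * ln_mu mu x `^ l = expR (l * v x y).
  rewrite /powR !gt_eqF ?ln_mu_gt0// -expRD.
  by congr expR; rewrite /v; ring.
have sumE x y : \sum_(i < 3) c i y * g i x =
    lambda1 * (expR (lambda2 * v x y) - 1) -
    lambda2 * (expR (lambda1 * v x y) - 1).
  transitivity ((lambda2 - lambda1) * 1 * 1 +
    (- lambda2 * ln_mu mu y `^ (- lambda1) * ln_mu mu x `^ lambda1 +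
    (lambda1 * ln_mu mu y `^ (- lambda2) * ln_mu mu x `^ lambda2 + 0))).
    by rewrite !big_ord_recl big_ord0.
  rewrite -!powM; ring.
apply: (korovkin_subset_penalty _ _ _ g c).
- by left; left.
- by move=> [[|[|[|]]]]//= ?; rewrite /g /=; [left; left|left; right|right].
- by move=> y; rewrite sumE /v subrr !mulr0 expR0 subrr !mulr0 subrr.
- move=> x y xy; rewrite sumE subr_gt0 expR_slope_lt//.
  rewrite /v subr_eq0; apply/eqP => /ln_inj.
  by rewrite !posrE !ln_mu_gt0// => /(_ isT isT)/(ln_mu_inj _ _ mu_gt0).
Qed.
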